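(* Let $s \ge 1$. For every $f \in \ell(\mathbb{Z}^s)$, $$\operatorname{rank} H(f) = \dim \mathcal{S}(f),$$ as an equality in $\mathbb{N}_0\cup\{\infty\}$.
   Context: $\mathbb{N}_0 = \{0,1,2,\dots\}$ and $\ell(\mathbb{Z}^s)$ is the complex vector space of all functions (sequences) $f:\mathbb{Z}^s\to\mathbb{C}$. For finite sets $A,B\subset\mathbb{Z}^s$ the Hankel matrix of $f$ is $H_{A,B}(f) = \big(f(\alpha+\beta)\big)_{\alpha\in A,\ \beta\in B}\in\mathbb{C}^{A\times B}$, and the rank of the Hankel operator $H(f)$ is $\operatorname{rank} H(f) = \sup\{\operatorname{rank} H_{A,B}(f) : A,B\subset\mathbb{Z}^s \text{ finite}\}\in\mathbb{N}_0\cup\{\infty\}$. For $\alpha\in\mathbb{Z}^s$ the translation operator is $\tau^\alpha f = f(\cdot+\alpha)$, and the shift invariant space generated by $f$ is $\mathcal{S}(f) = \operatorname{span}\{\tau^\alpha f : \alpha\in\mathbb{Z}^s\}\subseteq\ell(\mathbb{Z}^s)$. Infinite dimension is written as $\dim=\infty$, without distinguishing infinite cardinals. *)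

(* Defs.v *)
From HB Require Import structures.
From mathcomp Require Export all_boot all_order all_algebra finmap.
From mathcomp Require Export boolp classical_sets functions reals ereal.
From mathcomp Require Export complex.

Set Implicit Arguments.
Unset Strict Implicit.
Unset Printing Implicit Defensive.

Import Order.TTheory GRing.Theory Num.Theory.

Local Open Scope classical_set_scope.
Local Open Scope ring_scope.

(* The scalars are the complex numbers R[i] over an arbitrary model R of the
   real numbers. Values in N_0 u {oo} are represented in \bar R, a natural
   number n being n%:R%:E and oo being +oo. *)

Section LinearAlgebra.
Variables (R : realType) (V : lmodType R[i]).

(* Set of all finite linear combinations of elements of S. *)
Definition lin_span (S : set V) : set V :=
  [set v | exists (n : nat) (c : 'I_n -> R[i]) (w : 'I_n -> V),
     (forall i, S (w i)) /\ v = \sum_(i < n) c i *: w i].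

Definition lin_indep (n : nat) (b : 'I_n -> V) : Prop :=
  forall c : 'I_n -> R[i],
    \sum_(i < n) c i *: b i = 0 -> forall i, c i = 0.

Definition lin_basis (U : set V) (n : nat) (b : 'I_n -> V) : Prop :=
  lin_indep b /\ lin_span (range b) = U.

Definition has_basis_of_size (U : set V) : set nat :=
  [set n | exists b : 'I_n -> V, lin_basis U b].

(* xget selects the size of some finite basis; all of them have the same
   size. *)
Definition lin_dim (U : set V) : \bar R :=
  if `[< exists n, has_basis_of_size U n >]
  then ((xget 0%N (has_basis_of_size U))%:R)%:E
  else +oo%E.

End LinearAlgebra.

Section Hankel.
Variables (R : realType) (s : nat).

(* Row vectors of integers encode Z^s. The codomain carries ^o because R[i]
   also has a structure of R-module: ^o selects the R[i]-module structure, so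
   that this is a vector space over the complex numbers. *)
Definition ell : lmodType R[i] := 'rV[int]_s -> R[i]^o.

Definition translate (alpha : 'rV[int]_s) (f : ell) : ell :=
  fun x => f (x + alpha).

Definition shift_inv_space (f : ell) : set ell :=
  lin_span (range (fun alpha : 'rV[int]_s => translate alpha f)).

(* The finite sets A and B are enumerated to index rows and columns. *)
Definition hankel_mx (A B : {fset 'rV[int]_s}) (f : ell)
    : 'M[R[i]]_(#|` A|, #|` B|) :=
  \matrix_(i, j) f ((enum_fset A)`_i + (enum_fset B)`_j).

Definition hankel_rank (f : ell) : \bar R :=
  ereal_sup [set r : \bar R | exists A B : {fset 'rV[int]_s},
    r = ((\rank (hankel_mx A B f))%:R)%:E].

End Hankel.

(* Main.v *)
Require Import Defs.

Set Implicit Arguments.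
Unset Strict Implicit.
Unset Printing Implicit Defensive.

Import Order.TTheory GRing.Theory Num.Theory.

Local Open Scope classical_set_scope.
Local Open Scope ring_scope.

(** The Hankel operator is the matrix with row and column indices in Z^s whose
    row of index alpha is the translate of f by alpha. The theorem is therefore
    the equality of the rank of a matrix, given by its finite submatrices, with
    the dimension of its row space, and it holds for every matrix
    [h : X -> Y -> R[i]], of any size.

    A finite submatrix of rank r contains a nonsingular submatrix of size r
    ([nonsingular_of_rank]), so only nonsingular square submatrices matter. The
    rows of h that meet such a submatrix are linearly independent
    ([nonsingular_lin_indep]). If the submatrix has the largest possible size,
    these rows also span all the others ([max_nonsingular_span]): subtracting
    from another row the combination of them that agrees with it on the
    selected columns leaves a row which vanishes, because each of its entries
    is a Schur complement in a bordered submatrix, and a nonzero one would make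
    that larger submatrix nonsingular. Hence the largest size is the size of a
    basis of the row space. If there is no largest size, there are arbitrarily
    many independent rows, and [lin_indep_le] excludes a finite basis. *)

(** * Linear algebra in a complex vector space *)

Section Dimension.
Variables (R : realType) (V : lmodType R[i]).

Lemma lin_spanS (S : set V) v : S v -> lin_span S v.
Proof.
move=> Sv; exists 1%N, (fun=> 1), (fun=> v); split=> //.
by rewrite big_ord1 scale1r.
Qed.

(** The members of a family may be repeated or omitted in an element of
    [lin_span]; collecting terms gives one coefficient to each index, so that
    coefficients can be arranged in a matrix. *)
Lemma lin_span_rangeP n (b : 'I_n -> V) v :
  lin_span (range b) v <-> exists c : 'I_n -> R[i], v = \sum_(i < n) c i *: b i.
Proof.
split=> [[m [c [w [wb ->]]]]|[c ->]]; last first.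
  by exists n, c, b; split=> // i; exists i.
have /choice [g gE] : forall j, exists i, b i = w j.
  by move=> j; have [i _ <-] := wb j; exists i.
exists (fun i => \sum_(j < m | g j == i) c j).
rewrite (partition_big g xpredT) //=; apply: eq_bigr => i _.
by rewrite scaler_suml; apply: eq_bigr => j /eqP <-; rewrite gE.
Qed.

Lemma lin_span_sub (S : set V) n (b : 'I_n -> V) :
  (forall v, S v -> lin_span (range b) v) ->
  forall v, lin_span S v -> lin_span (range b) v.
Proof.
move=> Sb v [m [c [w [wS ->]]]]; apply/lin_span_rangeP.
have /choice [d dE] : forall j, exists e : 'I_n -> R[i],
    w j = \sum_(i < n) e i *: b i.
  by move=> j; apply/lin_span_rangeP; apply: Sb.
exists (fun i => \sum_(j < m) c j * d j i).
under eq_bigr => j _ do rewrite dE scaler_sumr.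
rewrite exchange_big /=; apply: eq_bigr => i _.
by rewrite scaler_suml; apply: eq_bigr => j _; rewrite scalerA.
Qed.

(** The coordinates of [b] over [w] form an n x m matrix, whose rows are free
    because [b] is; hence n is at most m. *)
Lemma lin_indep_le n m (b : 'I_n -> V) (w : 'I_m -> V) :
  lin_indep b -> (forall i, lin_span (range w) (b i)) -> (n <= m)%N.
Proof.
move=> bfree bw.
have /choice [d dE] : forall i, exists e : 'I_m -> R[i],
    b i = \sum_(j < m) e j *: w j.
  by move=> i; apply/lin_span_rangeP.
pose D : 'M[R[i]]_(n, m) := \matrix_(i, j) d i j.
suff /eqP <- : row_free D by exact: rank_leq_col.
apply: inj_row_free => u uD0; apply/rowP => i; rewrite mxE.
apply: (bfree (u 0)); under eq_bigr => k _ do rewrite dE scaler_sumr.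
rewrite exchange_big big1 //= => j _.
under eq_bigr => k _ do rewrite scalerA.
rewrite -scaler_suml -[RHS](scale0r (w j)); congr (_ *: _).
transitivity ((u *m D) 0 j); last by rewrite uD0 mxE.
by rewrite mxE; apply: eq_bigr => k _; rewrite mxE.
Qed.

Lemma lin_basis_le {U : set V} {n m} {b : 'I_n -> V} {w : 'I_m -> V} :
  lin_basis U b -> lin_basis U w -> (n <= m)%N.
Proof.
move=> [bfree bU] [_ wU]; apply: (lin_indep_le (w := w) bfree) => i.
by rewrite wU -bU; apply: lin_spanS; exists i.
Qed.

Lemma lin_dim_basis (U : set V) n (b : 'I_n -> V) :
  lin_basis U b -> lin_dim U = n%:R%:E.
Proof.
move=> bU; rewrite /lin_dim.
have Un : exists k, has_basis_of_size U k by exists n, b.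
rewrite asboolT //; have [w wU] := xgetPex 0%N Un.
congr (_%:R%:E); apply/eqP; rewrite eqn_leq.
by rewrite (lin_basis_le wU bU) (lin_basis_le bU wU).
Qed.

End Dimension.

(** * Rank and row space of an infinite matrix *)

Section Rank.
Variables (R : realType) (X Y : Type) (h : X -> Y -> R[i]^o).

Definition sample_mx m n (a : 'I_m -> X) (b : 'I_n -> Y) : 'M[R[i]]_(m, n) :=
  \matrix_(i, j) h (a i) (b j).

Definition nonsingular_size (n : nat) : Prop :=
  exists (a : 'I_n -> X) (b : 'I_n -> Y), sample_mx a b \in unitmx.

Lemma nonsingular_of_rank m n (a : 'I_m -> X) (b : 'I_n -> Y) :
  nonsingular_size (\rank (sample_mx a b)).
Proof.
set M := sample_mx a b.
(* Keep a maximal free set of rows, then one of columns, i.e. of rows of the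
   transpose. *)
pose M1 := rowsub (maxrankfun M) M.
have M1free : row_free M1 by exact: maxrowsub_free.
have rk1 : \rank M1^T = \rank M by rewrite mxrank_tr (eqP M1free).
pose M2 := rowsub (maxrankfun M1^T) M1^T.
have M2free : row_free M2 by exact: maxrowsub_free.
(* [M2] has \rank M1^T rows, equal to \rank M only propositionally: hence the
   casts. *)
pose q j := maxrankfun M1^T (cast_ord (esym rk1) j).
exists (a \o maxrankfun M), (b \o q).
rewrite -unitmx_tr -row_free_unit; apply: inj_row_free => v v0.
pose v' := castmx (erefl, esym rk1) v.
suff v'0 : v' = 0.
  by rewrite -[v](castmxK (erefl _) (esym rk1)) -/v' v'0 castmx_const.
apply: (row_free_inj M2free); rewrite mul0mx -[RHS]v0.
apply/rowP => j; rewrite !mxE (reindex (cast_ord (esym rk1))) /=; last first.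
  by exists (cast_ord rk1) => k _; rewrite ?cast_ordK ?cast_ordKV.
apply: eq_bigr => k _.
by rewrite !castmxE /= !mxE /q cast_ord_id esymK cast_ordKV.
Qed.

(** A linear relation between these rows restricts to the selected columns,
    where it is a relation between the rows of an invertible matrix. *)
Lemma nonsingular_lin_indep n (a : 'I_n -> X) (b : 'I_n -> Y) :
  sample_mx a b \in unitmx -> lin_indep (fun i => h (a i)).
Proof.
rewrite -row_free_unit => Mfree c c0 i.
suff -> : c i = (\row_k c k) 0 i.
  suff -> : \row_k c k = 0 by rewrite mxE.
  apply: (row_free_inj Mfree); rewrite mul0mx; apply/rowP => j; rewrite !mxE.
  have : (\sum_(k < n) c k *: (h (a k) : Y -> R[i]^o)) (b j) = 0 by rewrite c0.
  rewrite fct_sumE; apply: etrans.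
  by apply: eq_bigr => k _; rewrite !mxE.
by rewrite mxE.
Qed.

(** Block elimination: the determinant is multiplied by the Schur complement,
    which is a scalar here. *)
Lemma bordered_unitmx (K : fieldType) n (M : 'M[K]_n) (C : 'cV_n)
    (L : 'rV_n) (d : 'M_1) :
  M \in unitmx -> (d - L *m invmx M *m C) 0 0 != 0 ->
  block_mx M C L d \in unitmx.
Proof.
move=> Mu S0.
suff : block_mx 1%:M 0 (- (L *m invmx M)) 1%:M *m block_mx M C L d \in unitmx.
  by rewrite unitmx_mul => /andP[].
rewrite mulmx_block !mul1mx !mul0mx !addr0 !mulNmx mulmxKV // addNr.
by rewrite unitmxE det_ublock det_mx11 unitrM -unitmxE Mu unitfE addrC.
Qed.

(** By maximality no border can be added, so every Schur complement vanishes;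
    this says that the combination of the selected rows which agrees with row
    [x] on the selected columns agrees with it in every column. *)
Lemma max_nonsingular_span n (a : 'I_n -> X) (b : 'I_n -> Y) :
  sample_mx a b \in unitmx ->
  (forall m, nonsingular_size m -> (m <= n)%N) ->
  forall x, lin_span (range (fun i => h (a i))) (h x).
Proof.
set M := sample_mx a b => Mu nmax x; apply/lin_span_rangeP.
pose L : 'rV[R[i]]_n := \row_j h x (b j).
exists ((L *m invmx M) 0); apply/funext => y; rewrite fct_sumE.
pose C : 'cV[R[i]]_n := \col_i h (a i) y.
apply/eqP; rewrite -subr_eq0; apply: contraT => S0.
suff /nmax : nonsingular_size (n + 1)%N by rewrite addn1 ltnn.
exists (fun i : 'I_(n + 1) => if fintype.split i is inl k then a k else x).
exists (fun j : 'I_(n + 1) => if fintype.split j is inl k then b k else y).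
set M' := sample_mx _ _.
suff -> : M' = block_mx M C L (h x y)%:M.
  apply: bordered_unitmx => //; congr (_ != 0): S0.
  rewrite mxE mxE eqxx mulr1n mxE mxE; congr (_ - _).
  by apply: eq_bigr => k _; rewrite [C _ _]mxE.
apply/matrixP => i j; rewrite !mxE.
by case: (fintype.split i) => k; rewrite mxE; case: (fintype.split j) => l;
  rewrite !mxE ?ord1 ?eqxx.
Qed.

Lemma max_nonsingular_basis n (a : 'I_n -> X) (b : 'I_n -> Y) :
  sample_mx a b \in unitmx ->
  (forall m, nonsingular_size m -> (m <= n)%N) ->
  lin_basis (lin_span (range h)) (fun i => h (a i)).
Proof.
move=> Mu nmax; split; first exact: nonsingular_lin_indep Mu.
apply/seteqP; split=> v.
  move=> [m [c [w [wa ->]]]]; exists m, c, w; split=> // j.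
  by have [i _ <-] := wa j; exists (a i).
by apply: lin_span_sub => _ [x _ <-]; exact: max_nonsingular_span Mu nmax x.
Qed.

Lemma nonsingular_size_le_basis m n (w : 'I_n -> (Y -> R[i]^o)) :
  nonsingular_size m -> lin_basis (lin_span (range h)) w -> (m <= n)%N.
Proof.
move=> [a [b Mu]] [_ wU].
apply: (lin_indep_le (w := w) (nonsingular_lin_indep Mu)) => i.
by rewrite wU; apply: lin_spanS; exists (a i).
Qed.

Lemma lin_dim_row_space :
  lin_dim (lin_span (range h)) =
  ereal_sup [set n%:R%:E | n in nonsingular_size].
Proof.
have [[N PN]|unbounded] :=
    pselect (exists N, forall m, nonsingular_size m -> (m <= N)%N).
- have P0 : exists m, `[< nonsingular_size m >].
    (* The empty matrix is nonsingular. *)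
    exists 0%N; apply/asboolP.
    by exists (fun i : 'I_0 => False_rect _ (notF (ltn_ord i))),
      (fun i : 'I_0 => False_rect _ (notF (ltn_ord i)));
      rewrite unitmxE det_mx00 unitr1.
  have PN' m : `[< nonsingular_size m >] -> (m <= N)%N by move/asboolP/PN.
  have [n /asboolP Pn nmax'] := ex_maxnP P0 PN'.
  have nmax m : nonsingular_size m -> (m <= n)%N by move/asboolP/nmax'.
  have [a [b Mu]] := Pn.
  rewrite (lin_dim_basis (max_nonsingular_basis Mu nmax)).
  apply/le_anti/andP; split; first by apply: ereal_sup_ubound; exists n.
  by apply: ge_ereal_sup => _ [m /nmax mn <-]; rewrite lee_fin ler_nat.
- have large N : exists2 m, nonsingular_size m & (N < m)%N.
    apply: contrapT => none; apply: unbounded; exists N => m Pm.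
    by rewrite leqNgt; apply/negP => Nm; apply: none; exists m.
  rewrite /lin_dim asboolF => [|[n [w wU]]]; last first.
    have [m Pm nm] := large n.
    by have := nonsingular_size_le_basis Pm wU; rewrite leqNgt nm.
  apply/esym/eqyP => A A0; have [m Pm Am] := large (Num.bound A).
  apply: le_ereal_sup_tmp; exists m%:R%:E; first by exists m.
  rewrite lee_fin (le_trans (ltW (archi_boundP (ltW A0)))) // ler_nat.
  exact: ltnW.
Qed.

End Rank.

(** * Hankel matrices *)

Section HankelSamples.
Variables (R : realType) (s : nat) (f : ell R s).

Let h (alpha : 'rV[int]_s) : 'rV[int]_s -> R[i]^o := translate alpha f.

Lemma hankel_mxE (A B : {fset 'rV[int]_s}) :
  hankel_mx A B f =
  sample_mx h (fun i : 'I_(#|` A|) => (enum_fset A)`_i)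
              (fun j : 'I_(#|` B|) => (enum_fset B)`_j).
Proof. by apply/matrixP => i j; rewrite !mxE /h /translate addrC. Qed.

(** The sampled points, gathered into finite sets, index a Hankel matrix that
    has the sample as a submatrix. *)
Lemma sample_rank_le_hankel m n (a : 'I_m -> 'rV[int]_s)
    (b : 'I_n -> 'rV[int]_s) :
  exists A B : {fset 'rV[int]_s},
    (\rank (sample_mx h a b) <= \rank (hankel_mx A B f))%N.
Proof.
pose A := [fset a i | i in 'I_m]%fset; pose B := [fset b j | j in 'I_n]%fset.
have aA i : (index (a i) (enum_fset A) < #|` A|)%N.
  by rewrite index_mem; apply/imfsetP; exists i.
have bB j : (index (b j) (enum_fset B) < #|` B|)%N.
  by rewrite index_mem; apply/imfsetP; exists j.
exists A, B.
pose H := hankel_mx A B f.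
pose p i := Ordinal (aA i); pose q j := Ordinal (bB j).
have -> : sample_mx h a b = rowsub p 1%:M *m H *m colsub q 1%:M.
  rewrite mul_rowsub_mx mul1mx mulmx_colsub mulmx1.
  apply/matrixP => i j; rewrite !mxE /= !nth_index -?index_mem //.
  by rewrite /h /translate addrC.
exact: leq_trans (mxrankM_maxl _ _) (mxrankM_maxr _ _).
Qed.

Lemma hankel_rank_nonsingular :
  hankel_rank f = ereal_sup [set n%:R%:E | n in nonsingular_size h].
Proof.
apply/le_anti/andP; split; apply: ge_ereal_sup => r.
- move=> [A [B ->]]; rewrite hankel_mxE; apply: ereal_sup_ubound.
  by exists (\rank (sample_mx h (fun i : 'I_(#|` A|) => (enum_fset A)`_i)
    (fun j : 'I_(#|` B|) => (enum_fset B)`_j))) => //;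
    exact: nonsingular_of_rank.
- move=> [n [a [b /mxrank_unit Mn]] <-].
  have [A [B]] := sample_rank_le_hankel a b; rewrite Mn => nr.
  apply: le_ereal_sup_tmp; exists (\rank (hankel_mx A B f))%:R%:E.
    by exists A, B.
  by rewrite lee_fin ler_nat.
Qed.

End HankelSamples.

Theorem theorem2p2 (R : realType) (s : nat) (hs : (1 <= s)%N) (f : ell R s) :
  hankel_rank f = lin_dim (shift_inv_space f).
Proof.
by rewrite hankel_rank_nonsingular /shift_inv_space lin_dim_row_space.
Qed.
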